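(* Let $X$ be a Banach space, $\mathcal K\subset X$ a compact set, and let $\gamma_n=2^{\varphi(n)}$, where $\varphi:\mathbb N\to\mathbb R$ satisfies $\varphi(n)\geq c\log_2 n$ for some fixed constant $c>0$. Then: (i) for every $\alpha>0$ and $\beta\in\mathbb R$, $$\epsilon_n(\mathcal K)_X\gtrsim \frac{(\log_2 n)^\beta}{n^{\alpha}},\ n\in\mathbb N\quad\Rightarrow\quad d_n^{\gamma_n}(\mathcal K)_X\gtrsim[\log_2(n\varphi(n))]^{\beta}[n\varphi(n)]^{-\alpha},\ n\in\mathbb N;$$ (ii) for every $\alpha>0$, $$\epsilon_n(\mathcal K)_X\gtrsim[\log_2 n]^{-\alpha},\ n\in\mathbb N\quad\Rightarrow\quad d_n^{\gamma_n}(\mathcal K)_X\gtrsim[\log_2(n\varphi(n))]^{-\alpha},\ n\in\mathbb N.$$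
   Context: Entropy numbers: $\epsilon_n(\mathcal K)_X$, $n\ge0$, is the infimum of all $\epsilon>0$ for which $\mathcal K$ is covered by $2^n$ balls of radius $\epsilon$ with centers in $X$. Lipschitz widths: for a norm $\|\cdot\|_{Y_n}$ on $\mathbb R^n$ let $B_{Y_n}(1)$ be its closed unit ball. For $\gamma>0$, $$d^\gamma(\mathcal K,Y_n)_X:=\inf_{\mathcal L_n}\sup_{f\in\mathcal K}\inf_{y\in B_{Y_n}(1)}\|f-\mathcal L_n(y)\|_X,$$ the infimum being over all maps $\mathcal L_n:(B_{Y_n}(1),\|\cdot\|_{Y_n})\to X$ that are Lipschitz with constant $\gamma$; and $d_n^\gamma(\mathcal K)_X:=\inf_{\|\cdot\|_{Y_n}}d^\gamma(\mathcal K,Y_n)_X$, the infimum being over all norms on $\mathbb R^n$. Asymptotic notation: for expressions $A,B$ depending on $n$, $A\gtrsim B$ means that there is a constant $c>0$ independent of $n$ with $A\ge cB$ as $n\to\infty$ (i.e. for all sufficiently large $n$, so that the logarithmic expressions are well defined). *)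

(* Defs.v *)
From HB Require Import structures.
From mathcomp Require Import all_boot all_order all_algebra.
From mathcomp Require Import all_classical all_reals all_analysis.

Set Implicit Arguments.
Unset Strict Implicit.
Unset Printing Implicit Defensive.

Import Order.TTheory GRing.Theory Num.Theory.
Import numFieldNormedType.Exports.

Local Open Scope classical_set_scope.
Local Open Scope ring_scope.

Definition log2 (R : realType) (x : R) : R := ln x / ln 2.

Definition entropy_number (R : realType) (X : normedModType R)
    (n : nat) (K : set X) : \bar R :=
  ereal_inf [set e%:E | e in [set e : R | 0 < e /\
    exists g : 'I_(2 ^ n) -> X, K `<=` \bigcup_i closed_ball (g i) e]].

(* The library's norms are attached to types; here the norm on R^n must be a
   variable, since the width is an infimum over all of them.  Nonnegativity
   follows from these three axioms. *)
Record is_norm (R : realType) (n : nat) (N : 'rV[R]_n -> R) : Prop := IsNorm {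
  norm_triangle : forall x y, N (x + y) <= N x + N y;
  norm_homogeneous : forall (a : R) x, N (a *: x) = `|a| * N x;
  norm_definite : forall x, N x = 0 -> x = 0 }.

Definition unit_ball (R : realType) (n : nat) (N : 'rV[R]_n -> R) :
  set 'rV[R]_n := [set y | N y <= 1].

(* A map defined on the unit ball is represented by a total map, of which only
   the values on the ball matter. *)
Definition lipschitz_on_unit_ball (R : realType) (X : normedModType R)
    (gamma : R) (n : nat) (N : 'rV[R]_n -> R) (L : 'rV[R]_n -> X) : Prop :=
  forall y z, unit_ball N y -> unit_ball N z ->
    `|L y - L z| <= gamma * N (y - z).

Definition lipschitz_width_norm (R : realType) (X : normedModType R)
    (gamma : R) (n : nat) (K : set X) (N : 'rV[R]_n -> R) : \bar R :=
  ereal_inf [set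
    ereal_sup [set
      ereal_inf [set `|f - L y|%:E | y in unit_ball N]
    | f in K]
  | L in [set L : 'rV[R]_n -> X | lipschitz_on_unit_ball gamma N L]].

Definition lipschitz_width (R : realType) (X : normedModType R)
    (gamma : R) (n : nat) (K : set X) : \bar R :=
  ereal_inf [set lipschitz_width_norm gamma K N
            | N in [set N : 'rV[R]_n -> R | is_norm N]].

(* The relation A >~ B: entropy numbers and widths are extended reals, the
   comparison sequences are real. *)
Definition asymp_ge (R : realType) (A : nat -> \bar R) (B : nat -> R) : Prop :=
  exists2 c : R, 0 < c & \forall n \near \oo, ((c * B n)%:E <= A n)%E.

(* Main.v *)
(* Suppose [d_n^gamma(K) < delta].  A [gamma]-Lipschitz map on the unit ball of
   some norm on [R^n] then comes [delta]-close to [K], so a covering of the ball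
   by [2^m] sets of diameter [delta / gamma] gives [epsilon_m(K) <= 2 delta].
   Instead of the volumetric covering bound, cells of a grid in almost Auerbach
   coordinates are used: they give [m = n (p + 2)] as soon as
   [2^p >= gamma n / delta].  The extra factor [n] is harmless, because
   [gamma = 2^phi(n)] is at least a power of [n]: for [delta] comparable to the
   claimed lower bound one can take [p] of order [phi(n)], hence [m] of order
   [n phi(n)], and the bound on [epsilon_m(K)] yields a contradiction.  Claim
   (ii) is the case [a = 0], [b = - alpha] of (i). *)
Require Import Defs.
From HB Require Import structures.
From mathcomp Require Import all_boot all_order all_algebra.
From mathcomp Require Import all_classical all_reals all_analysis.
From mathcomp Require Import perm ring lra.

Import Order.TTheory GRing.Theory Num.Theory.
Import numFieldNormedType.Exports.

Local Open Scope classical_set_scope.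
Local Open Scope ring_scope.

(** * Norms on [R^n]: equivalence with the sup norm, almost Auerbach bases, grid cells *)

Section Norms.
Context {R : realType} {n : nat} {N : 'rV[R]_n -> R} (hN : is_norm N).

Lemma is_norm0 : N 0 = 0.
Proof. by rewrite -(scale0r 0) (norm_homogeneous hN) normr0 mul0r. Qed.

Lemma is_normN x : N (- x) = N x.
Proof. by rewrite -scaleN1r (norm_homogeneous hN) normrN1 mul1r. Qed.

Lemma is_norm_ge0 x : 0 <= N x.
Proof.
have := norm_triangle hN x (- x).
by rewrite subrr is_norm0 is_normN; lra.
Qed.

Lemma is_norm_sum (I : finType) (F : I -> 'rV[R]_n) :
  N (\sum_i F i) <= \sum_i N (F i).
Proof.
elim/big_ind2: _ => [|x a y b xa yb|//]; first by rewrite is_norm0.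
by rewrite (le_trans (norm_triangle hN _ _))// lerD.
Qed.

Lemma coord_le_norm (x : 'rV[R]_n) i j : `|x i j| <= `|x|.
Proof.
rewrite (_ : `|x| = mx_norm x)// mx_normrE.
exact: (le_bigmax 0 (fun ij : 'I_1 * 'I_n => `|x ij.1 ij.2|) (i, j)).
Qed.

Lemma is_norm_le_sup : exists2 C, 0 < C & forall x, N x <= C * `|x|.
Proof.
(* The summand 1 keeps the constant positive even for [n = 0]. *)
exists (1 + \sum_(j < n) N 'e_j).
  by rewrite ltr_pwDl ?sumr_ge0// => j _; exact: is_norm_ge0.
move=> x; rewrite {1}(row_sum_delta x) (le_trans (is_norm_sum _ _))//.
rewrite mulrDl mul1r ler_wpDl// mulr_suml ler_sum// => j _.
by rewrite (norm_homogeneous hN) mulrC ler_wpM2l ?is_norm_ge0 ?coord_le_norm.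
Qed.

Lemma is_norm_continuous : continuous N.
Proof.
have [C C0 NC] := is_norm_le_sup.
move=> x; apply/(@cvgrPdist_le _ _ _ _ (nbhs_filter x)) => e e0.
apply: filterS (@cvgr_dist_le _ _ _ (nbhs x) (nbhs_filter x) id x
  cvg_id _ (divr_gt0 e0 C0)) => y /= xy.
have h : N (x - y) <= e.
  by rewrite (le_trans (NC _))// mulrC -ler_pdivlMr.
have := norm_triangle hN y (x - y); have := norm_triangle hN x (y - x).
rewrite !subrKC -(is_normN (y - x)) opprB.
by rewrite ler_norml; lra.
Qed.

(** The sup-norm unit sphere is compact, so the continuous [N] attains a minimum there, positive by
    definiteness; homogeneity does the rest. For [n = 0] the sphere is empty. *)
Lemma is_norm_ge_sup : exists2 m, 0 < m & forall x, m * `|x| <= N x.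
Proof.
pose S := [set x : 'rV[R]_n | `|x| = 1].
have [m m0 mS] : exists2 m, 0 < m & forall x, S x -> m <= N x.
  have [S0|/set0P S0] := eqVneq S set0; first by exists 1 => // x; rewrite S0.
  have cS : compact S.
    apply: bounded_closed_compact; first by
      exists 1; split => // M M1 x /= ->; exact: ltW.
    rewrite (_ : S = Num.norm @^-1` [set 1])//.
    by apply: closed_comp; [move=> ? _; exact: norm_continuous|exact: closed_eq].
  have [x xS xmin] := compact_EVT_min S0 cS
    (continuous_subspaceT is_norm_continuous).
  exists (N x); last by move=> y yS; apply: xmin; rewrite inE.
  rewrite lt_neqAle is_norm_ge0 andbT eq_sym; apply/eqP => /(norm_definite hN) x0.
  by move: xS; rewrite inE /S /= x0 normr0 => /eqP; rewrite eq_sym oner_eq0.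
exists m => // x; have [->|x0] := eqVneq x 0.
  by rewrite normr0 mulr0 is_norm0.
have : S (`|x|^-1 *: x).
  by rewrite /S /= normrZ normfV normr_id mulVf ?normr_eq0.
move/mS; rewrite (norm_homogeneous hN) normfV normr_id mulrC.
by rewrite ler_pdivlMr ?normr_gt0.
Qed.

Lemma det_bounded (B : R) (A : 'M[R]_n) : (forall i j, `|A i j| <= B) ->
  `|\det A| <= (n`!)%:R * B ^+ n.
Proof.
move=> AB; rewrite (le_trans (ler_norm_sum _ _ _))//.
rewrite (le_trans (_ : _ <= \sum_(s : 'S_n) B ^+ n))//.
  apply: ler_sum => s _; rewrite normrM normrX normrN1 expr1n mul1r normr_prod.
  rewrite -[n in B ^+ n]card_ord -prodr_const.
  by apply: ler_prod => i _; rewrite normr_ge0 AB.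
by rewrite sumr_const card_Sn mulr_natl.
Qed.

(* An Auerbach basis up to a factor 2: nearly maximize [|det|] over tuples of
   the unit ball, then bound the coordinates by Cramer's rule. *)
Lemma near_auerbach : exists2 A : 'M[R]_n, (forall i, unit_ball N (row i A)) &
  forall y, unit_ball N y -> exists2 a : 'rV[R]_n, y = a *m A &
    forall i, `|a 0 i| < 2.
Proof.
have [m m0 Nm] := is_norm_ge_sup; have [C C0 NC] := is_norm_le_sup.
pose balls (A : 'M[R]_n) := forall i, unit_ball N (row i A).
pose D := [set `|\det A| | A in balls].
have bA A i j : balls A -> `|A i j| <= m^-1.
  move=> /(_ i) /= Ai; have := coord_le_norm (row i A) 0 j.
  rewrite mxE => /le_trans; apply.
  by rewrite -[m^-1]mulr1 mulrC ler_pdivlMr// mulrC (le_trans (Nm _)).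
(* The rows of this scalar matrix lie in the ball, so the supremum is positive and a near maximizer
   is invertible. *)
have D0 : D `|\det (C^-1%:M : 'M[R]_n)|.
  exists C^-1%:M => // i; rewrite /unit_ball /= (le_trans (NC _))//.
  rewrite -ler_pdivlMl// mulr1 (_ : `|_| = mx_norm (row i C^-1%:M))//.
  rewrite mx_normrE bigmax_le ?invr_ge0 ?(ltW C0)// => -[j k] _ /=.
  by rewrite !mxE; case: eqP; rewrite ?normr0 ?invr_ge0 ?(ltW C0) ?gtr0_norm ?invr_gt0.
have supD : has_sup D.
  split; first by exists `|\det (C^-1%:M : 'M[R]_n)|.
  exists ((n`!)%:R * m^-1 ^+ n) => _ [A hA <-].
  by apply: det_bounded => i j; exact: bA.
have s0 : 0 < sup D.
  apply: lt_le_trans (ub_le_sup (proj2 supD) D0).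
  by rewrite det_scalar normr_gt0 expf_neq0// invr_neq0 ?gt_eqF.
have [_ [A hA <-] hs] := sup_adherent (divr_gt0 s0 (ltr0n _ 2)) supD.
have dA : 0 < `|\det A| by rewrite (le_lt_trans _ hs)//; lra.
have uA : A \in unitmx by rewrite unitmxE unitfE -normr_gt0.
exists A => // y yB; exists (y *m invmx A); first by rewrite mulmxKV.
(* Replacing row [i] by [y] keeps all rows in the ball, so the determinant is at most [sup D], which
   is less than twice that of [A] in absolute value. *)
move=> i; pose A' := \matrix_j (if j == i then y else row j A).
have DA' : D `|\det A'|.
  by exists A' => // j; rewrite rowK; case: ifP => // _; exact: hA.
have -> : (y *m invmx A) 0 i = \det A' / \det A.
  rewrite /invmx uA -scalemxAr !mxE mulrC; congr (_ / _).
  rewrite (expand_det_row _ i); apply: eq_bigr => j _.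
  rewrite !mxE eqxx; congr (_ * (_ * \det _)).
  apply/matrixP => k l; rewrite !mxE eq_sym (negPf (neq_lift _ _)).
  by rewrite mxE.
rewrite normrM normfV ltr_pdivrMr// (le_lt_trans (ub_le_sup (proj2 supD) DA'))//.
by move: hs; lra.
Qed.

(** Coordinates in the almost Auerbach basis lie in [(-2, 2)]; rounding them to step [1 / q] leaves
    [4 q] values each. Points of one cell differ by at most [1 / q] per coordinate, and the [n]
    basis vectors have norm at most 1. *)
Lemma unit_ball_cells (q : nat) : (0 < q)%N ->
  exists cell : 'rV[R]_n -> {ffun 'I_n -> 'I_(q * 4)},
  forall y z, unit_ball N y -> unit_ball N z -> cell y = cell z ->
    N (y - z) <= n%:R / q%:R.
Proof.
case: q => // q _; have [A Aball coordA] := near_auerbach.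
have /choice[a ha] : forall y, exists a : 'rV[R]_n, unit_ball N y ->
    y = a *m A /\ forall i, `|a 0 i| < 2.
  move=> y; have [/coordA[a ? ?]|?] := pselect (unit_ball N y); first by exists a.
  by exists 0.
(* The shift by 2 makes the argument nonnegative, so that [truncn] is the floor; [lt4] shows that
   [inord] loses nothing. *)
exists (fun y => [ffun i => inord (Num.truncn (q.+1%:R * (a y 0 i + 2)))]).
move=> y z /ha[ya ay] /ha[za az] cyz.
have close i : `|a y 0 i - a z 0 i| <= q.+1%:R^-1.
  have pos (t : R) : `|t| < 2 -> 0 <= q.+1%:R * (t + 2).
    by rewrite ltr_norml => /andP[t2 _]; rewrite mulr_ge0//; lra.
  have lt4 (t : R) : `|t| < 2 -> (Num.truncn (q.+1%:R * (t + 2)) < q.+1 * 4)%N.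
    move=> t2; rewrite truncn_lt_nat ?pos// natrM ltr_pM2l ?ltr0n//.
    by move: t2; rewrite ltr_norml; lra.
  move: cyz => /ffunP/(_ i)/(congr1 val).
  rewrite !ffunE /= !inordK ?lt4// => eqt.
  have /andP[] := truncn_itv (pos _ (ay i)); have /andP[] := truncn_itv (pos _ (az i)).
  have q0 : 0 < q.+1%:R :> R by rewrite ltr0n.
  rewrite eqt -natr1 => l1 u1 l2 u2.
  rewrite -[leRHS]mul1r ler_pdivlMr// -[X in _ * X]gtr0_norm// -normrM ler_norml.
  by move: l1 u1 l2 u2; lra.
rewrite ya za -mulmxBl mulmx_sum_row (le_trans (is_norm_sum _ _))//.
rewrite (le_trans (_ : _ <= \sum_(i < n) q.+1%:R^-1))//.
  apply: ler_sum => i _; rewrite (norm_homogeneous hN) !mxE.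
  by rewrite -[leRHS]mulr1 ler_pM ?is_norm_ge0//; exact: Aball.
by rewrite sumr_const card_ord mulr_natl.
Qed.
End Norms.

(** * From a Lipschitz map to a covering *)

Lemma entropy_number_le_lipschitz_width (R : realType) (X : normedModType R)
    (K : set X) (gamma delta : R) (n p : nat) :
  0 <= gamma -> 0 < delta -> gamma * n%:R <= delta * 2 ^+ p ->
  (lipschitz_width gamma n K < delta%:E)%E ->
  (entropy_number (n * (p + 2)) K <= (2 * delta)%:E)%E.
Proof.
move=> g0 d0 hp /ereal_inf_lt[_ [N hN <-]] /ereal_inf_lt[_ [L hL <-]] hK.
have p0 : (0 < 2 ^ p)%N by rewrite expn_gt0.
have [cell hcell] := unit_ball_cells hN _ p0.
have card : (2 ^ (n * (p + 2)) = #|{ffun 'I_n -> 'I_(2 ^ p * 4)}|)%N.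
  by rewrite card_ffun !card_ord mulnC expnM expnD.
pose centre t := xget 0 [set y | unit_ball N y /\ cell y = t].
apply: ereal_inf_lbound; exists (2 * delta) => //=; split; first by rewrite mulr_gt0.
exists (fun i => L (centre (enum_val (cast_ord card i)))) => f Kf.
have : (ereal_inf [set `|f - L y|%:E | y in unit_ball N] < delta%:E)%E.
  by apply: le_lt_trans hK; apply: ereal_sup_ubound; exists f.
move=> /ereal_inf_lt[_ [y By <-]]; rewrite lte_fin => fy.
exists (cast_ord (esym card) (enum_rank (cell y))) => //.
rewrite cast_ordKV enum_rankK closed_ballE ?mulr_gt0// /closed_ball_ /=.
have [Bc cc] : unit_ball N (centre (cell y)) /\ cell (centre (cell y)) = cell y.
  exact: (@xgetI _ 0 [set z | unit_ball N z /\ cell z = cell y] y).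
have Lyc : `|L y - L (centre (cell y))| <= delta.
  rewrite (le_trans (hL _ _ By Bc))//.
  rewrite (le_trans (ler_wpM2l g0 (hcell _ _ By Bc (esym cc))))//.
  by rewrite mulrA ler_pdivrMr ?ltr0n// natrX.
rewrite distrC -(subrKA (L y)) (le_trans (ler_normD _ _))//; lra.
Qed.

(** * Growth of products of powers and logarithms *)

Section LogPower.
Context {R : realType}.
Implicit Types (a b s t x D : R).

Lemma ln2_gt0 : 0 < ln (2 : R).
Proof. by rewrite ln_gt0// ltr1n. Qed.

Lemma log2M : {in Num.pos &, {morph @log2 R : x y / x * y >-> x + y}}.
Proof. by move=> x y x0 y0; rewrite /log2 lnM// mulrDl. Qed.

Lemma log2_powR x : log2 (2 `^ x) = x.
Proof. by rewrite /log2 ln_powR mulfK// gt_eqF// ln2_gt0. Qed.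

Lemma powR_log2 x : 0 < x -> 2 `^ (log2 x) = x.
Proof.
move=> x0; rewrite /powR pnatr_eq0 /= /log2 divfK ?lnK// gt_eqF//.
exact: ln2_gt0.
Qed.

Lemma le_log2 x y : 0 < x -> x <= y -> log2 x <= log2 y.
Proof.
move=> x0 xy; rewrite /log2 ler_pM2r ?invr_gt0 ?ln2_gt0//.
by rewrite ler_ln// posrE// (lt_le_trans x0).
Qed.

Lemma log2_ge1 t : 2 <= t -> 1 <= log2 t.
Proof.
move=> t2; apply: le_trans (le_log2 2 t _ t2) => //.
by rewrite /log2 divff// gt_eqF// ln2_gt0.
Qed.

Lemma log2_le t : 0 < t -> log2 t <= 2 * t.
Proof.
move=> t0; rewrite /log2 ler_pdivrMr ?ln2_gt0//.
have h2 : 2^-1 <= ln (2 : R).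
  have := @le_ln1Dx R (- 2^-1) ltac:(lra).
  rewrite (_ : 1 + - 2^-1 = 2^-1 :> R); last lra.
  by rewrite lnV ?posrE//; lra.
have : ln t <= t - 1.
  by rewrite -[t in leLHS](subrKC 1) le_ln1Dx//; lra.
nra.
Qed.

(** Since [1 <= log2 t <= 2 t <= t ^ 2], the logarithmic factor costs at most a power of [t]. *)
Lemma logpow_lower a b t : 2 <= t -> 0 <= a ->
  t `^ (- (a + 2 * `|b|)) <= log2 t `^ b * t `^ (- a).
Proof.
move=> t2 a0; have t0 : 0 < t by lra.
have l1 := log2_ge1 t t2.
rewrite opprD addrC powRD; last by rewrite (gt_eqF t0) implybT.
rewrite ler_wpM2r ?powR_ge0// (le_trans (_ : _ <= log2 t `^ (- `|b|)))//; last first.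
  by rewrite ler_powR// lerNl -normrN ler_norm.
rewrite !powRN lef_pV2 ?posrE ?powR_gt0//; last lra.
rewrite powRrM ge0_ler_powR ?nnegrE ?powR_ge0//; first lra.
by rewrite powR_mulrn ?(ltW t0)//; have := log2_le t t0; nra.
Qed.

(** This moves the entropy bound from index [n (p + 2)] back to the comparable [n phi(n)]. The
    logarithm grows by a factor of at most [1 + log2 D], because [log2 t >= 1]. *)
Lemma logpow_scale a b D : 0 <= a -> 1 <= D -> exists2 k, 0 < k &
  forall s t, 2 <= t -> t <= s -> s <= D * t ->
    k * (log2 t `^ b * t `^ (- a)) <= log2 s `^ b * s `^ (- a).
Proof.
move=> a0 D1; have D0 : 0 < D by lra.
have lD : 0 <= log2 D by rewrite divr_ge0 ?ln_ge0 ?ler1n.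
exists ((1 + log2 D) `^ (- `|b|) * D `^ (- a)).
  by rewrite mulr_gt0 ?powR_gt0//; lra.
move=> s t t2 ts sDt; have t0 : 0 < t by lra.
have s0 : 0 < s by lra.
have lt1 := log2_ge1 t t2.
have lts := le_log2 t s t0 ts.
have lsD : log2 s <= (1 + log2 D) * log2 t.
  apply: le_trans (le_log2 s _ s0 sDt) _; rewrite log2M//; nra.
rewrite mulrACA ler_pM ?mulr_ge0 ?powR_ge0//; last first.
  rewrite -powRM ?(ltW D0) ?(ltW t0)// !powRN lef_pV2 ?posrE ?powR_gt0 ?mulr_gt0//.
  by rewrite ge0_ler_powR ?nnegrE ?(ltW s0) ?mulr_ge0 ?(ltW D0) ?(ltW t0).
(* For [b >= 0] the logarithmic power increases and its constant is at most 1; for [b < 0] the bound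
   [lsD] is needed. *)
have [b0|b0] := leP 0 b.
  rewrite -[leRHS]mul1r ler_pM ?powR_ge0//.
    rewrite -[leRHS](powRr0 (1 + log2 D)) ler_powR ?oppr_le0//; lra.
  by rewrite ge0_ler_powR ?nnegrE//; lra.
rewrite ltr0_norm// opprK -powRM; [|lra|lra].
rewrite -[b]opprK !(powRN _ (- b)) lef_pV2 ?posrE ?powR_gt0//; [|lra|nra].
by rewrite ge0_ler_powR ?nnegrE//; lra.
Qed.
End LogPower.

(** * The common form of both claims *)

Lemma asymp_ge_lipschitz_width (R : realType) (X : normedModType R) (K : set X)
    (phi : nat -> R) (c a b : R) : 0 < c ->
  (forall n : nat, (0 < n)%N -> c * log2 (n%:R : R) <= phi n) -> 0 <= a ->
  asymp_ge (fun n => entropy_number n K)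
    (fun n => log2 (n%:R : R) `^ b * n%:R `^ (- a)) ->
  asymp_ge (fun n => lipschitz_width (2 `^ phi n) n K)
    (fun n => log2 (n%:R * phi n) `^ b * (n%:R * phi n) `^ (- a)).
Proof.
move=> c0 hphi a0 [e e0 [n0 _ hn0]].
(* With [F = phi n] and [t = n F], these give [B >= t ^ (- A)] and [t <= 2 ^ (q F)]. In [C], the
   terms pay for [gamma = 2 ^ F] and [e' >= 2 ^ (- F)] (the 2), for [n <= 2 ^ (F / c)], and for
   [B]. *)
pose A := a + 2 * `|b|; pose q := c^-1 + 2; pose C := 2 + c^-1 + A * q.
have ci0 : 0 < c^-1 by rewrite invr_gt0.
have A0 : 0 <= A by rewrite addr_ge0// mulr_ge0.
have q0 : 0 < q by rewrite addr_gt0.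
have C2 : 2 <= C by rewrite /C -addrA lerDl addr_ge0 ?mulr_ge0// ltW.
have [k k0 hk] := logpow_scale a b (C + 3) a0 ltac:(lra).
(* The factor [k] pays for the change of index; 4 absorbs the 2 of [2 * delta] and leaves a strict
   inequality for the contradiction. *)
pose e' := e * k / 4.
have e'0 : 0 < e' by rewrite divr_gt0// mulr_gt0.
exists e' => //.
have large_phi M : \forall n \near \oo, M <= phi n.
  near=> n.
  have n0' : (0 < n)%N by near: n; exact: nbhs_infty_gt.
  apply: le_trans (hphi n n0'); rewrite mulrC -ler_pdivrMr// -(log2_powR (M / c)).
  apply: le_log2; first by rewrite powR_gt0.
  by near: n; exact: nbhs_infty_ger.
near=> n.
have n2 : (2 <= n)%N by near: n; exact: nbhs_infty_ge.
have nn0 : (n0 <= n)%N by near: n; exact: nbhs_infty_ge.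
have F1 : 1 <= phi n by near: n; exact: large_phi.
have Fe : log2 e'^-1 <= phi n by near: n; exact: large_phi.
have nF := hphi n (ltnW n2).
set F := phi n in F1 Fe nF *.
have n2R : 2 <= n%:R :> R by rewrite ler_nat.
set t := n%:R * F; have t2 : 2 <= t by rewrite /t; nra.
have nexp : n%:R <= 2 `^ (F / c).
  rewrite -[leLHS]powR_log2 ?ler_powR ?ler1n//; last lra.
  by rewrite ler_pdivlMr// mulrC.
have texp : t <= 2 `^ (q * F).
  rewrite /q mulrDl powRD ?pnatr_eq0 ?implybT// [c^-1 * F]mulrC.
  rewrite ler_pM//; first lra.
  rewrite -[leLHS]powR_log2; last lra.
  by rewrite ler_powR ?ler1n// log2_le//; lra.
set B := log2 t `^ b * t `^ (- a).
have Bexp : 2 `^ (- (A * q * F)) <= B.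
  apply: le_trans (logpow_lower a b t t2 a0); rewrite -/A !powRN lef_pV2 ?posrE ?powR_gt0//; last lra.
  rewrite -mulrA (mulrC A) powRrM ge0_ler_powR ?nnegrE ?powR_ge0//; lra.
have e'exp : 2 `^ (- F) <= e'.
  rewrite powRN invf_ple ?posrE ?powR_gt0//.
  rewrite -[leLHS]powR_log2 ?invr_gt0// ler_powR// ler1n//.
have B0 : 0 < B by apply: lt_le_trans Bexp; rewrite powR_gt0.
rewrite leNgt; apply/negP => width_lt.
(* Rounding [C F] up costs at most 1, so [t <= n (p + 2) <= (C + 3) t] because [F >= 1]. *)
pose p := (Num.truncn (C * F)).+1.
have CF0 : 0 <= C * F by rewrite mulr_ge0; lra.
have CFp : C * F <= p%:R by apply/ltW; exact: truncnS_gt.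
have pCF : p%:R <= C * F + 1.
  by rewrite /p -natr1 lerD2r; have /andP[] := truncn_itv CF0.
have grid : 2 `^ F * n%:R <= e' * B * 2 ^+ p.
  apply: (@le_trans _ _ (2 `^ (- F) * 2 `^ (- (A * q * F)) * 2 `^ (C * F))).
    rewrite -!powRD ?pnatr_eq0 ?implybT//.
    rewrite (_ : _ + _ = F + F / c); last by rewrite /C; ring.
    by rewrite powRD ?pnatr_eq0 ?implybT// ler_wpM2l ?powR_ge0.
  rewrite ler_pM ?mulr_ge0 ?powR_ge0//; first by rewrite ler_pM ?powR_ge0.
  by rewrite -powR_mulrn// ler_powR// ler1n.
have := entropy_number_le_lipschitz_width _ _ _ _ _ _ _
  (powR_ge0 _ _) (mulr_gt0 e'0 B0) grid width_lt.
have m0 : (n0 <= n * (p + 2))%N.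
  by rewrite (leq_trans nn0)// leq_pmulr// addn2.
have /= := hn0 _ m0.
move=> /le_trans/[apply]; rewrite lee_fin; apply/negP; rewrite -ltNge.
have tm : t <= (n * (p + 2))%:R.
  by rewrite natrM natrD ler_wpM2l//; nra.
have mt : (n * (p + 2))%:R <= (C + 3) * t.
  by rewrite natrM natrD mulrCA ler_wpM2l//; lra.
have hB := hk _ t t2 tm mt.
apply: lt_le_trans (ler_wpM2l (ltW e0) hB); rewrite -/B /e'.
by have := mulr_gt0 (mulr_gt0 e0 k0) B0; lra.
Unshelve. all: by end_near. Qed.

Theorem theorem5p4 (R : realType) (X : completeNormedModType R) (K : set X)
    (hK : compact K) (phi : nat -> R) (c : R) (hc : 0 < c)
    (hphi : forall n : nat, (0 < n)%N -> c * log2 (n%:R : R) <= phi n) :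
  (forall alpha beta : R, 0 < alpha ->
     asymp_ge (fun n => entropy_number n K)
       (fun n => log2 (n%:R : R) `^ beta / n%:R `^ alpha) ->
     asymp_ge (fun n => lipschitz_width (2 `^ phi n) n K)
       (fun n => log2 (n%:R * phi n) `^ beta * (n%:R * phi n) `^ (- alpha)))
  /\
  (forall alpha : R, 0 < alpha ->
     asymp_ge (fun n => entropy_number n K)
       (fun n => log2 (n%:R : R) `^ (- alpha)) ->
     asymp_ge (fun n => lipschitz_width (2 `^ phi n) n K)
       (fun n => log2 (n%:R * phi n) `^ (- alpha))).
Proof.
split=> [alpha beta alpha0 hK_ge|alpha alpha0 hK_ge].
  apply: (asymp_ge_lipschitz_width _ _ _ _ _ _ _ hc hphi (ltW alpha0)).
  by move: hK_ge; congr (asymp_ge _ _); apply/funext => n; rewrite powRN.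
(* A power with exponent 0 is 1 even at base 0, so the equality holds at every index. *)
have mul1E (f : nat -> R) : (fun n => log2 (f n) `^ (- alpha)) =
    (fun n => log2 (f n) `^ (- alpha) * f n `^ (- 0)).
  by apply/funext => n; rewrite oppr0 powRr0 mulr1.
rewrite (mul1E (fun n => n%:R * phi n)).
apply: (asymp_ge_lipschitz_width _ _ _ _ _ _ _ hc hphi (lexx 0)).
by rewrite -(mul1E (fun n => n%:R)).
Qed.
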